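(* Every typed term (of any of the three kinds: $c$-term, $l$-term, $r$-term) of the simply typed $\overline{\lambda}\mu\tilde{\mu}$-calculus is strongly normalizing for the $l$-reduction $\triangleright_l$, i.e. there is no infinite sequence of $\triangleright_l$-steps starting from it.
   Context: Syntax of the $\overline{\lambda}\mu\tilde{\mu}$-calculus. There are $l$-variables $x,y,\dots$ and $r$-variables $\alpha,\beta,\dots$, and three kinds of terms: $c ::= \langle t_l,t_r\rangle$ ($c$-terms); $t_l ::= x \mid \lambda x\, t_l \mid \mu\alpha\, c \mid t_r.t_l$ ($l$-terms); $t_r ::= \alpha \mid \lambda\alpha\, t_r \mid \mu x\, c \mid t_l.t_r$ ($r$-terms). The constructors $\lambda x,\lambda\alpha,\mu x,\mu\alpha$ bind their variable; terms are considered up to renaming of bound variables and substitution is capture-avoiding. Types are built from atomic formulas with the binary connectives $\rightarrow$ and $-$. An $l$-context $\Gamma$ is a set of declarations $x:A$; an $r$-context $\Delta$ is a set of declarations $\alpha:A$. Judgments are of the forms $c:(\Gamma\vdash\Delta)$, $\Gamma\vdash [t_l:A],\Delta$ and $\Gamma,[t_r:A]\vdash\Delta$ (the bracketed formula is the distinguished one). Typing rules: - $\Gamma,x:A\vdash[x:A],\Delta$ and $\Gamma,[\alpha:A]\vdash\alpha:A,\Delta$ (axioms); - from $\Gamma,x:A\vdash[t_l:B],\Delta$ infer $\Gamma\vdash[\lambda x\,t_l:A\rightarrow B],\Delta$; - from $\Gamma\vdash[t_l:A],\Delta$ and $\Gamma,[t_r:B]\vdash\Delta$ infer $\Gamma,[t_l.t_r:A\rightarrow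 B]\vdash\Delta$; - from $\Gamma\vdash[t_l:A],\Delta$ and $\Gamma,[t_r:B]\vdash\Delta$ infer $\Gamma\vdash[t_r.t_l:A-B],\Delta$; - from $\Gamma,[t_r:A]\vdash\alpha:B,\Delta$ infer $\Gamma,[\lambda\alpha\,t_r:A-B]\vdash\Delta$; - from $\Gamma\vdash[t_l:A],\Delta$ and $\Gamma,[t_r:A]\vdash\Delta$ infer $\langle t_l,t_r\rangle:(\Gamma\vdash\Delta)$; - from $c:(\Gamma\vdash\alpha:A,\Delta)$ infer $\Gamma\vdash[\mu\alpha\,c:A],\Delta$; - from $c:(\Gamma,x:A\vdash\Delta)$ infer $\Gamma,[\mu x\,c:A]\vdash\Delta$. A term is typed if it occurs as subject of a derivable judgment. The $l$-reduction $\triangleright_l$ is the closure under all term constructors of the rules (bound variables being renamed to avoid capture): - $\langle\lambda x\,t_l,\,t'_l.t_r\rangle\triangleright_{\lambda}\langle t'_l,\,\mu x\,\langle t_l,t_r\rangle\rangle$; - $\langle t'_r.t_l,\,\lambda\alpha\,t_r\rangle\triangleright_{\overline{\lambda}}\langle\mu\alpha\,\langle t_l,t_r\rangle,\,t'_r\rangle$; - $\langle\mu\alpha\,c,\,t_r\rangle\triangleright_{\mu}c[\alpha:=t_r]$; - $\langle t_l,\,\mu x\,c\rangle\triangleright_{\tilde\mu}c[x:=t_l]$. *)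

(* Defs.v *)
From Stdlib Require Import List.
Import ListNotations.

(** Terms up to renaming of bound variables, in de Bruijn form.  The [l]-variables
    and the [r]-variables have independent index spaces: [LLam] ([lambda x]) and
    [RMu] ([mu x]) bind the [l]-index 0 and leave the [r]-indices alone, whereas
    [RLam] ([lambda alpha]) and [LMu] ([mu alpha]) bind the [r]-index 0 and leave
    the [l]-indices alone. *)

Inductive cterm : Type :=
| Cut (t : lterm) (u : rterm)         (* <t, u> *)
with lterm : Type :=
| LVar (n : nat)                      (* x *)
| LLam (t : lterm)                    (* lambda x t *)
| LMu (c : cterm)                     (* mu alpha c *)
| LApp (u : rterm) (t : lterm)        (* u.t *)
with rterm : Type :=
| RVar (n : nat)                      (* alpha *)
| RLam (u : rterm)                    (* lambda alpha u *)
| RMu (c : cterm)                     (* mu x c *)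
| RApp (t : lterm) (u : rterm).       (* t.u *)

Definition scons {X : Type} (a : X) (f : nat -> X) (n : nat) : X :=
  match n with
  | 0 => a
  | S m => f m
  end.

Definition up_ren (f : nat -> nat) : nat -> nat :=
  scons 0 (fun n => S (f n)).

Fixpoint ren_c (f g : nat -> nat) (c : cterm) : cterm :=
  match c with
  | Cut t u => Cut (ren_l f g t) (ren_r f g u)
  end
with ren_l (f g : nat -> nat) (t : lterm) : lterm :=
  match t with
  | LVar n => LVar (f n)
  | LLam t => LLam (ren_l (up_ren f) g t)
  | LMu c => LMu (ren_c f (up_ren g) c)
  | LApp u t => LApp (ren_r f g u) (ren_l f g t)
  end
with ren_r (f g : nat -> nat) (u : rterm) : rterm :=
  match u with
  | RVar n => RVar (g n)
  | RLam u => RLam (ren_r f (up_ren g) u)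
  | RMu c => RMu (ren_c (up_ren f) g c)
  | RApp t u => RApp (ren_l f g t) (ren_r f g u)
  end.

(** [shift_X_Y] views a [Y]-term under one additional binder of [X]-variables. *)

Definition shift_l_l : lterm -> lterm := ren_l S (fun n => n).
Definition shift_r_l : lterm -> lterm := ren_l (fun n => n) S.
Definition shift_l_r : rterm -> rterm := ren_r S (fun n => n).
Definition shift_r_r : rterm -> rterm := ren_r (fun n => n) S.

(** Simultaneous capture-avoiding substitution of [s] for the [l]-variables and
    [k] for the [r]-variables. *)

Definition up_l (s : nat -> lterm) : nat -> lterm :=
  scons (LVar 0) (fun n => shift_l_l (s n)).
Definition up_r (k : nat -> rterm) : nat -> rterm :=
  scons (RVar 0) (fun n => shift_r_r (k n)).

Fixpoint subst_c (s : nat -> lterm) (k : nat -> rterm) (c : cterm) : cterm :=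
  match c with
  | Cut t u => Cut (subst_l s k t) (subst_r s k u)
  end
with subst_l (s : nat -> lterm) (k : nat -> rterm) (t : lterm) : lterm :=
  match t with
  | LVar n => s n
  | LLam t => LLam (subst_l (up_l s) (fun n => shift_l_r (k n)) t)
  | LMu c => LMu (subst_c (fun n => shift_r_l (s n)) (up_r k) c)
  | LApp u t => LApp (subst_r s k u) (subst_l s k t)
  end
with subst_r (s : nat -> lterm) (k : nat -> rterm) (u : rterm) : rterm :=
  match u with
  | RVar n => k n
  | RLam u => RLam (subst_r (fun n => shift_r_l (s n)) (up_r k) u)
  | RMu c => RMu (subst_c (up_l s) (fun n => shift_l_r (k n)) c)
  | RApp t u => RApp (subst_l s k t) (subst_r s k u)
  end.

(** [c[x := t]] and [c[alpha := u]] for the outermost bound variable. *)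

Definition subst0_l (t : lterm) (c : cterm) : cterm :=
  subst_c (scons t LVar) RVar c.
Definition subst0_r (u : rterm) (c : cterm) : cterm :=
  subst_c LVar (scons u RVar) c.

(** [step_c], [step_l], [step_r]: the closure of the four rules under all term
    constructors, on each kind of terms.  The shifts perform the renaming of the
    variable bound by the new [mu] away from the term that it did not bind. *)

Inductive step_c : cterm -> cterm -> Prop :=
| step_lambda t t' u :
    step_c (Cut (LLam t) (RApp t' u))
           (Cut t' (RMu (Cut t (shift_l_r u))))
| step_lambda_bar u' t u :
    step_c (Cut (LApp u' t) (RLam u))
           (Cut (LMu (Cut (shift_r_l t) u)) u')
| step_mu c u :
    step_c (Cut (LMu c) u) (subst0_r u c)
| step_mu_tilde t c :
    step_c (Cut t (RMu c)) (subst0_l t c)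
| step_Cut_l t t' u :
    step_l t t' -> step_c (Cut t u) (Cut t' u)
| step_Cut_r t u u' :
    step_r u u' -> step_c (Cut t u) (Cut t u')
with step_l : lterm -> lterm -> Prop :=
| step_LLam t t' :
    step_l t t' -> step_l (LLam t) (LLam t')
| step_LMu c c' :
    step_c c c' -> step_l (LMu c) (LMu c')
| step_LApp_r u u' t :
    step_r u u' -> step_l (LApp u t) (LApp u' t)
| step_LApp_l u t t' :
    step_l t t' -> step_l (LApp u t) (LApp u t')
with step_r : rterm -> rterm -> Prop :=
| step_RLam u u' :
    step_r u u' -> step_r (RLam u) (RLam u')
| step_RMu c c' :
    step_c c c' -> step_r (RMu c) (RMu c')
| step_RApp_l t t' u :
    step_l t t' -> step_r (RApp t u) (RApp t' u)
| step_RApp_r t u u' :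
    step_r u u' -> step_r (RApp t u) (RApp t u').

Inductive type (Atom : Type) : Type :=
| Atomic (a : Atom)
| Arrow (A B : type Atom)
| Minus (A B : type Atom).

Arguments Atomic {Atom} a.
Arguments Arrow {Atom} A B.
Arguments Minus {Atom} A B.

(** A context is the list of the types of the variables, indexed by de Bruijn index.
    [typing_c G c D] is [c : (G |- D)], [typing_l G t A D] is [G |- [t : A], D], and
    [typing_r G u A D] is [G, [u : A] |- D]. *)

Definition context (Atom : Type) : Type := list (type Atom).

Inductive typing_c {Atom : Type} :
  context Atom -> cterm -> context Atom -> Prop :=
| T_Cut G D t u A :
    typing_l G t A D -> typing_r G u A D -> typing_c G (Cut t u) D
with typing_l {Atom : Type} :
  context Atom -> lterm -> type Atom -> context Atom -> Prop :=
| T_LVar G D n A :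
    nth_error G n = Some A -> typing_l G (LVar n) A D
| T_LLam G D t A B :
    typing_l (A :: G) t B D -> typing_l G (LLam t) (Arrow A B) D
| T_LApp G D u t A B :
    typing_l G t A D -> typing_r G u B D -> typing_l G (LApp u t) (Minus A B) D
| T_LMu G D c A :
    typing_c G c (A :: D) -> typing_l G (LMu c) A D
with typing_r {Atom : Type} :
  context Atom -> rterm -> type Atom -> context Atom -> Prop :=
| T_RVar G D n A :
    nth_error D n = Some A -> typing_r G (RVar n) A D
| T_RApp G D t u A B :
    typing_l G t A D -> typing_r G u B D -> typing_r G (RApp t u) (Arrow A B) D
| T_RLam G D u A B :
    typing_r G u A (B :: D) -> typing_r G (RLam u) (Minus A B) D
| T_RMu G D c A :
    typing_c (A :: G) c D -> typing_r G (RMu c) A D.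

Definition typed_c (Atom : Type) (c : cterm) : Prop :=
  exists G D : context Atom, typing_c G c D.
Definition typed_l (Atom : Type) (t : lterm) : Prop :=
  exists (G : context Atom) (A : type Atom) (D : context Atom), typing_l G t A D.
Definition typed_r (Atom : Type) (u : rterm) : Prop :=
  exists (G : context Atom) (A : type Atom) (D : context Atom), typing_r G u A D.

Definition strongly_normalizing {T : Type} (R : T -> T -> Prop) (t : T) : Prop :=
  ~ exists f : nat -> T, f 0 = t /\ forall n : nat, R (f n) (f (S n)).

(* Main.v *)
From Stdlib Require Import List FunctionalExtensionality.
Require Import Defs.

(** Symmetric reducibility candidates (Barbanera and Berardi).  A type is interpreted
    by a set [L] of [l]-terms and a set [R] of [r]-terms such that [<t,u>] is strongly
    normalizing for all [t] in [L] and [u] in [R].  Because of the critical pair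
    [<mu alpha c, mu x c'>], neither side can be defined before the other: [mu alpha c]
    should be in [L] when [c[alpha := u]] is strongly normalizing for every [u] in [R],
    and symmetrically.  Each of the two conditions is antitone in the other set, so their
    composition is monotone, and [L] is taken to be its least fixed point.  Every
    candidate contains all the variables, so the identity substitution is reducible. *)

(* Mutual induction principles for terms, reduction and typing *)
Scheme cterm_mut := Induction for cterm Sort Prop
  with lterm_mut := Induction for lterm Sort Prop
  with rterm_mut := Induction for rterm Sort Prop.
Combined Scheme term_mutind from cterm_mut, lterm_mut, rterm_mut.

Scheme step_c_mut := Minimality for step_c Sort Prop
  with step_l_mut := Minimality for step_l Sort Prop
  with step_r_mut := Minimality for step_r Sort Prop.
Combined Scheme step_mutind from step_c_mut, step_l_mut, step_r_mut.

Scheme typing_c_mut := Minimality for typing_c Sort Prop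
  with typing_l_mut := Minimality for typing_l Sort Prop
  with typing_r_mut := Minimality for typing_r Sort Prop.
Combined Scheme typing_mutind from typing_c_mut, typing_l_mut, typing_r_mut.

(** * Substitution *)

Ltac by_cases_on_index :=
  let n := fresh "n" in
  apply functional_extensionality; intros n; try (destruct n; reflexivity).

(** First of the four composition laws for renamings and substitutions. Their order matters: under a
    binder, [ren_subst] needs [ren_ren] to move a shift past the lifted renaming, and [subst_subst]
    needs [subst_ren] and [ren_subst]. *)
Lemma ren_ren :
  (forall c f g f' g',
     ren_c f g (ren_c f' g' c) = ren_c (fun n => f (f' n)) (fun n => g (g' n)) c) /\
  (forall t f g f' g',
     ren_l f g (ren_l f' g' t) = ren_l (fun n => f (f' n)) (fun n => g (g' n)) t) /\
  (forall u f g f' g',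
     ren_r f g (ren_r f' g' u) = ren_r (fun n => f (f' n)) (fun n => g (g' n)) u).
Proof.
  apply term_mutind; simpl; intros; f_equal; auto;
    rewrite H; f_equal; by_cases_on_index.
Qed.

Definition ren_ren_l := proj1 (proj2 ren_ren).
Definition ren_ren_r := proj2 (proj2 ren_ren).

Lemma subst_ren :
  (forall c s k f g,
     subst_c s k (ren_c f g c) = subst_c (fun n => s (f n)) (fun n => k (g n)) c) /\
  (forall t s k f g,
     subst_l s k (ren_l f g t) = subst_l (fun n => s (f n)) (fun n => k (g n)) t) /\
  (forall u s k f g,
     subst_r s k (ren_r f g u) = subst_r (fun n => s (f n)) (fun n => k (g n)) u).
Proof.
  apply term_mutind; simpl; intros; f_equal; auto;
    rewrite H; f_equal; by_cases_on_index.
Qed.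

Definition subst_ren_l := proj1 (proj2 subst_ren).
Definition subst_ren_r := proj2 (proj2 subst_ren).

Lemma ren_subst :
  (forall c s k f g,
     ren_c f g (subst_c s k c) =
     subst_c (fun n => ren_l f g (s n)) (fun n => ren_r f g (k n)) c) /\
  (forall t s k f g,
     ren_l f g (subst_l s k t) =
     subst_l (fun n => ren_l f g (s n)) (fun n => ren_r f g (k n)) t) /\
  (forall u s k f g,
     ren_r f g (subst_r s k u) =
     subst_r (fun n => ren_l f g (s n)) (fun n => ren_r f g (k n)) u).
Proof.
  apply term_mutind; simpl; intros; f_equal; auto;
    rewrite H; f_equal; apply functional_extensionality; intros n;
    try (destruct n; [reflexivity |]);
    unfold up_l, up_r, scons, shift_l_l, shift_l_r, shift_r_l, shift_r_r;
    rewrite ?ren_ren_l, ?ren_ren_r; reflexivity.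
Qed.

Definition ren_subst_l := proj1 (proj2 ren_subst).
Definition ren_subst_r := proj2 (proj2 ren_subst).

Lemma subst_subst :
  (forall c s k s' k',
     subst_c s k (subst_c s' k' c) =
     subst_c (fun n => subst_l s k (s' n)) (fun n => subst_r s k (k' n)) c) /\
  (forall t s k s' k',
     subst_l s k (subst_l s' k' t) =
     subst_l (fun n => subst_l s k (s' n)) (fun n => subst_r s k (k' n)) t) /\
  (forall u s k s' k',
     subst_r s k (subst_r s' k' u) =
     subst_r (fun n => subst_l s k (s' n)) (fun n => subst_r s k (k' n)) u).
Proof.
  apply term_mutind; simpl; intros; f_equal; auto;
    rewrite H; f_equal; apply functional_extensionality; intros n;
    try (destruct n; [reflexivity |]);
    unfold up_l, up_r, scons, shift_l_l, shift_l_r, shift_r_l, shift_r_r;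
    rewrite ?subst_ren_l, ?subst_ren_r, ?ren_subst_l, ?ren_subst_r; reflexivity.
Qed.

Definition subst_subst_c := proj1 subst_subst.
Definition subst_subst_l := proj1 (proj2 subst_subst).
Definition subst_subst_r := proj2 (proj2 subst_subst).

Lemma up_l_LVar : up_l LVar = LVar.
Proof. by_cases_on_index. Qed.

Lemma up_r_RVar : up_r RVar = RVar.
Proof. by_cases_on_index. Qed.

Lemma subst_id :
  (forall c, subst_c LVar RVar c = c) /\
  (forall t, subst_l LVar RVar t = t) /\
  (forall u, subst_r LVar RVar u = u).
Proof.
  apply term_mutind; simpl; intros; f_equal; auto;
    rewrite ?up_l_LVar, ?up_r_RVar; assumption.
Qed.

Definition subst_id_c := proj1 subst_id.
Definition subst_id_l := proj1 (proj2 subst_id).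
Definition subst_id_r := proj2 (proj2 subst_id).

Lemma subst_shift_l_l a s k t :
  subst_l (scons a s) k (shift_l_l t) = subst_l s k t.
Proof. exact (subst_ren_l _ _ _ _ _). Qed.

Lemma subst_shift_l_r a s k u :
  subst_r (scons a s) k (shift_l_r u) = subst_r s k u.
Proof. exact (subst_ren_r _ _ _ _ _). Qed.

Lemma subst_shift_r_l b s k t :
  subst_l s (scons b k) (shift_r_l t) = subst_l s k t.
Proof. exact (subst_ren_l _ _ _ _ _). Qed.

Lemma subst_shift_r_r b s k u :
  subst_r s (scons b k) (shift_r_r u) = subst_r s k u.
Proof. exact (subst_ren_r _ _ _ _ _). Qed.

(** Lifting a substitution under a binder and then instantiating the bound variable amounts to
    extending it by one entry, because the instantiation cancels the shifts. *)
Lemma up_l_inst a s :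
  (fun n => subst_l (scons a LVar) RVar (up_l s n)) = scons a s.
Proof.
  apply functional_extensionality; intros [|n]; [reflexivity |].
  simpl. rewrite subst_shift_l_l. apply subst_id_l.
Qed.

Lemma up_r_inst b k :
  (fun n => subst_r LVar (scons b RVar) (up_r k n)) = scons b k.
Proof.
  apply functional_extensionality; intros [|n]; [reflexivity |].
  simpl. rewrite subst_shift_r_r. apply subst_id_r.
Qed.

Lemma shift_l_r_inst a (k : nat -> rterm) :
  (fun n => subst_r (scons a LVar) RVar (shift_l_r (k n))) = k.
Proof.
  apply functional_extensionality; intros n.
  rewrite subst_shift_l_r. apply subst_id_r.
Qed.

Lemma shift_r_l_inst b (s : nat -> lterm) :
  (fun n => subst_l LVar (scons b RVar) (shift_r_l (s n))) = s.
Proof.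
  apply functional_extensionality; intros n.
  rewrite subst_shift_r_l. apply subst_id_l.
Qed.

Lemma subst0_l_subst a s k c :
  subst0_l a (subst_c (up_l s) (fun n => shift_l_r (k n)) c) =
  subst_c (scons a s) k c.
Proof.
  unfold subst0_l. rewrite subst_subst_c, up_l_inst, shift_l_r_inst. reflexivity.
Qed.

Lemma subst0_r_subst b s k c :
  subst0_r b (subst_c (fun n => shift_r_l (s n)) (up_r k) c) =
  subst_c s (scons b k) c.
Proof.
  unfold subst0_r. rewrite subst_subst_c, up_r_inst, shift_r_l_inst. reflexivity.
Qed.

Lemma subst_l_up_inst a s k t :
  subst_l (scons a LVar) RVar (subst_l (up_l s) (fun n => shift_l_r (k n)) t) =
  subst_l (scons a s) k t.
Proof. rewrite subst_subst_l, up_l_inst, shift_l_r_inst. reflexivity. Qed.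

Lemma subst_r_up_inst b s k u :
  subst_r LVar (scons b RVar) (subst_r (fun n => shift_r_l (s n)) (up_r k) u) =
  subst_r s (scons b k) u.
Proof. rewrite subst_subst_r, up_r_inst, shift_r_l_inst. reflexivity. Qed.

(** The substitution lemma: both sides equal [c] under the extension of [s] by the instance of [a].
    It makes the rule for [mu x] stable under substitution. *)
Lemma subst_subst0_l a s k c :
  subst_c s k (subst0_l a c) =
  subst0_l (subst_l s k a) (subst_c (up_l s) (fun n => shift_l_r (k n)) c).
Proof.
  rewrite subst0_l_subst. unfold subst0_l. rewrite subst_subst_c.
  f_equal. by_cases_on_index.
Qed.

Lemma subst_subst0_r b s k c :
  subst_c s k (subst0_r b c) =
  subst0_r (subst_r s k b) (subst_c (fun n => shift_r_l (s n)) (up_r k) c).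
Proof.
  rewrite subst0_r_subst. unfold subst0_r. rewrite subst_subst_c.
  f_equal. by_cases_on_index.
Qed.

Lemma subst_up_shift_l_r s k u :
  subst_r (up_l s) (fun n => shift_l_r (k n)) (shift_l_r u) =
  shift_l_r (subst_r s k u).
Proof. unfold shift_l_r. rewrite subst_ren_r, ren_subst_r. reflexivity. Qed.

Lemma subst_up_shift_r_l s k t :
  subst_l (fun n => shift_r_l (s n)) (up_r k) (shift_r_l t) =
  shift_r_l (subst_l s k t).
Proof. unfold shift_r_l. rewrite subst_ren_l, ren_subst_l. reflexivity. Qed.

(** * Strong normalization *)

Lemma step_subst :
  (forall c c', step_c c c' -> forall s k, step_c (subst_c s k c) (subst_c s k c')) /\
  (forall t t', step_l t t' -> forall s k, step_l (subst_l s k t) (subst_l s k t')) /\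
  (forall u u', step_r u u' -> forall s k, step_r (subst_r s k u) (subst_r s k u')).
Proof.
  apply step_mutind; simpl; intros;
    rewrite ?subst_up_shift_l_r, ?subst_up_shift_r_l,
      ?subst_subst0_l, ?subst_subst0_r;
    constructor; auto.
Qed.

Definition step_subst_c := proj1 step_subst.
Definition step_subst_l := proj1 (proj2 step_subst).
Definition step_subst_r := proj2 (proj2 step_subst).

Definition SN {T : Type} (R : T -> T -> Prop) : T -> Prop := Acc (fun x y => R y x).

Lemma SN_strongly_normalizing {T : Type} (R : T -> T -> Prop) (x : T) :
  SN R x -> strongly_normalizing R x.
Proof.
  intros Hx [f [H0 Hf]]. revert f H0 Hf.
  induction Hx as [x _ IH]. intros f H0 Hf.
  apply (IH (f 1)) with (f := fun n => f (S n)); auto.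
  rewrite <- H0. apply Hf.
Qed.

(** A reduction sequence from [x] is mapped by [h] to one from [h x]. With [h] a substitution, a
    term is strongly normalizing as soon as one of its instances is. *)
Lemma SN_preimage {T U : Type} (R : T -> T -> Prop) (Q : U -> U -> Prop) (h : T -> U) :
  (forall x y, R x y -> Q (h x) (h y)) -> forall x, SN Q (h x) -> SN R x.
Proof.
  intros Hh x Hx. remember (h x) as y eqn:E. revert x E.
  induction Hx as [y _ IH]. intros x ->.
  constructor. intros x' Hx'. exact (IH (h x') (Hh _ _ Hx') x' eq_refl).
Qed.

Lemma SN_subst_c s k c : SN step_c (subst_c s k c) -> SN step_c c.
Proof.
  apply SN_preimage with (h := subst_c s k). intros; now apply step_subst_c.
Qed.

Lemma SN_subst_l s k t : SN step_l (subst_l s k t) -> SN step_l t.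
Proof.
  apply SN_preimage with (h := subst_l s k). intros; now apply step_subst_l.
Qed.

Lemma SN_subst_r s k u : SN step_r (subst_r s k u) -> SN step_r u.
Proof.
  apply SN_preimage with (h := subst_r s k). intros; now apply step_subst_r.
Qed.

Lemma SN_LMu c : SN step_c c -> SN step_l (LMu c).
Proof.
  induction 1 as [c _ IH]. constructor. intros t Ht. inversion Ht; subst. now apply IH.
Qed.

Lemma SN_RMu c : SN step_c c -> SN step_r (RMu c).
Proof.
  induction 1 as [c _ IH]. constructor. intros t Ht. inversion Ht; subst. now apply IH.
Qed.

Lemma SN_LLam t : SN step_l t -> SN step_l (LLam t).
Proof.
  induction 1 as [t _ IH]. constructor. intros t' Ht. inversion Ht; subst. now apply IH.
Qed.

Lemma SN_RLam u : SN step_r u -> SN step_r (RLam u).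
Proof.
  induction 1 as [u _ IH]. constructor. intros u' Hu. inversion Hu; subst. now apply IH.
Qed.

Lemma SN_LApp u t : SN step_r u -> SN step_l t -> SN step_l (LApp u t).
Proof.
  intros Hu. revert t. induction Hu as [u Hu IHu]. intros t Ht.
  induction Ht as [t Ht IHt].
  constructor. intros t' Hs. inversion Hs; subst; [| now apply IHt].
  (* The outer hypothesis asks for accessibility of [t], which the inner induction has split into
     [Ht] and must be rebuilt. *)
  apply IHu; [assumption |]. now constructor.
Qed.

Lemma SN_RApp t u : SN step_l t -> SN step_r u -> SN step_r (RApp t u).
Proof.
  intros Ht. revert u. induction Ht as [t Ht IHt]. intros u Hu.
  induction Hu as [u Hu IHu].
  constructor. intros u' Hs. inversion Hs; subst; [| now apply IHu].
  apply IHt; [assumption |]. now constructor.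
Qed.

(** * Candidates *)

(** [V] supplies the [LLam] and [LApp] terms, the values of the type; variables and [mu]
    abstractions are treated uniformly in all types. *)
Definition neg_l (V : lterm -> Prop) (R : rterm -> Prop) (t : lterm) : Prop :=
  match t with
  | LVar _ => True
  | LMu c => forall u, R u -> SN step_c (subst0_r u c)
  | _ => V t
  end.

Definition neg_r (E : rterm -> Prop) (L : lterm -> Prop) (u : rterm) : Prop :=
  match u with
  | RVar _ => True
  | RMu c => forall t, L t -> SN step_c (subst0_l t c)
  | _ => E u
  end.

(** The intersection of all pre-fixed points of the monotone operator sending [X] to
    [neg_l V (neg_r E X)], which is its least fixed point by Knaster and Tarski. *)
Definition polar_l (V : lterm -> Prop) (E : rterm -> Prop) (t : lterm) : Prop :=
  forall X : lterm -> Prop, (forall t', neg_l V (neg_r E X) t' -> X t') -> X t.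

Definition polar_r (V : lterm -> Prop) (E : rterm -> Prop) : rterm -> Prop :=
  neg_r E (polar_l V E).

Lemma neg_l_antitone V (R R' : rterm -> Prop) :
  (forall u, R u -> R' u) -> forall t, neg_l V R' t -> neg_l V R t.
Proof. intros H [n|t|c|u t]; simpl; auto. Qed.

Lemma neg_r_antitone E (L L' : lterm -> Prop) :
  (forall t, L t -> L' t) -> forall u, neg_r E L' u -> neg_r E L u.
Proof. intros H [n|u|c|t u]; simpl; auto. Qed.

Lemma polar_l_fold V E t : neg_l V (polar_r V E) t -> polar_l V E t.
Proof.
  (* The intersection lies below every pre-fixed point [X], so by monotonicity its image lies below
     the image of [X], hence below [X]. *)
  intros Ht X HX. apply HX. revert t Ht. apply neg_l_antitone.
  apply neg_r_antitone. intros t Ht. exact (Ht X HX).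
Qed.

Lemma polar_l_unfold V E t : polar_l V E t -> neg_l V (polar_r V E) t.
Proof.
  (* The image of the intersection is itself a pre-fixed point, by monotonicity and [polar_l_fold],
     so it contains the intersection. *)
  intros Ht. apply Ht. apply neg_l_antitone. apply neg_r_antitone.
  apply polar_l_fold.
Qed.

Record candidate (L : lterm -> Prop) (R : rterm -> Prop) : Prop := {
  cand_LVar : forall n, L (LVar n);
  cand_RVar : forall n, R (RVar n);
  cand_LMu : forall c, (forall u, R u -> SN step_c (subst0_r u c)) -> L (LMu c);
  cand_RMu : forall c, (forall t, L t -> SN step_c (subst0_l t c)) -> R (RMu c);
  cand_SN_l : forall t, L t -> SN step_l t;
  cand_SN_r : forall u, R u -> SN step_r u;
  cand_step_l : forall t t', L t -> step_l t t' -> L t';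
  cand_step_r : forall u u', R u -> step_r u u' -> R u';
  cand_Cut : forall t u, L t -> R u -> SN step_c (Cut t u)
}.

(** The fixed-point equations settle the cuts involving [mu], so the last two hypotheses concern
    only the head contractions between values. *)
Lemma polar_candidate (V : lterm -> Prop) (E : rterm -> Prop) :
  (forall t, V t -> SN step_l t) ->
  (forall u, E u -> SN step_r u) ->
  (forall t t', V t -> step_l t t' -> V t') ->
  (forall u u', E u -> step_r u u' -> E u') ->
  (forall t t' u, V (LLam t) -> E (RApp t' u) ->
     SN step_c (Cut t' (RMu (Cut t (shift_l_r u))))) ->
  (forall u' t u, V (LApp u' t) -> E (RLam u) ->
     SN step_c (Cut (LMu (Cut (shift_r_l t) u)) u')) ->
  candidate (polar_l V E) (polar_r V E).
Proof.
  intros SNV SNE stepV stepE Hlam Hbar.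
  assert (SNl : forall t, polar_l V E t -> SN step_l t).
  { intros t Ht. apply polar_l_unfold in Ht. destruct t as [n|t|c|u t]; auto.
    - constructor. intros t' H. inversion H.
    (* Every variable is in [polar_r], so the body has a strongly normalizing instance. *)
    - apply SN_LMu. exact (SN_subst_c _ _ _ (Ht (RVar 0) I)). }
  assert (SNr : forall u, polar_r V E u -> SN step_r u).
  { intros u Hu. destruct u as [n|u|c|t u]; auto.
    - constructor. intros u' H. inversion H.
    - apply SN_RMu. refine (SN_subst_c _ _ _ (Hu (LVar 0) _)).
      now apply polar_l_fold. }
  assert (stepl : forall t t', polar_l V E t -> step_l t t' -> polar_l V E t').
  { intros t t' Ht H. apply polar_l_unfold in Ht. apply polar_l_fold.
    destruct H; simpl in *;
      try (eapply stepV; [exact Ht | now constructor]).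
    intros u Hu. apply (Acc_inv (Ht u Hu)). now apply step_subst_c. }
  assert (stepr : forall u u', polar_r V E u -> step_r u u' -> polar_r V E u').
  { intros u u' Hu H. unfold polar_r in *.
    destruct H; simpl in *;
      try (eapply stepE; [exact Hu | now constructor]).
    intros t Ht. apply (Acc_inv (Hu t Ht)). now apply step_subst_c. }
  constructor; auto.
  - intros n. now apply polar_l_fold.
  - intros n. exact I.
  - intros c Hc. now apply polar_l_fold.
  (* Nested induction on the strong normalization of [t] and of [u]. The memberships are carried
     along, since they pass to reducts and are needed again for each new cut. *)
  - intros t u Ht Hu. generalize (SNl t Ht). intros At. revert u Hu Ht.
    induction At as [t _ IHt]. intros u Hu Ht.
    generalize (SNr u Hu). intros Au.
    induction Au as [u _ IHu].
    constructor. intros c' H. inversion H; subst.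
    + apply Hlam; [exact (polar_l_unfold _ _ _ Ht) | exact Hu].
    + apply Hbar; [exact (polar_l_unfold _ _ _ Ht) | exact Hu].
    (* The two [mu] contractions follow from the membership of the side that contracts, whatever the
       shape of the other side; this covers the critical pair. *)
    + exact (polar_l_unfold _ _ _ Ht u Hu).
    + exact (Hu t Ht).
    + apply IHt; eauto.
    + apply IHu; eauto.
Qed.

(** * Interpretation of the types *)

Definition arrow_l (LA LB : lterm -> Prop) (t : lterm) : Prop :=
  match t with
  | LLam t => forall a, LA a -> LB (subst_l (scons a LVar) RVar t)
  | _ => False
  end.

Definition arrow_r (LA : lterm -> Prop) (RB : rterm -> Prop) (u : rterm) : Prop :=
  match u with
  | RApp t u => LA t /\ RB u
  | _ => False
  end.

Definition minus_l (LA : lterm -> Prop) (RB : rterm -> Prop) (t : lterm) : Prop :=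
  match t with
  | LApp u t => LA t /\ RB u
  | _ => False
  end.

Definition minus_r (RA RB : rterm -> Prop) (u : rterm) : Prop :=
  match u with
  | RLam u => forall b, RB b -> RA (subst_r LVar (scons b RVar) u)
  | _ => False
  end.

(** An atomic type has no values, so its candidate is made of variables and [mu] abstractions
    only. *)
Fixpoint red {Atom} (A : type Atom) : (lterm -> Prop) * (rterm -> Prop) :=
  let polar V E := (polar_l V E, polar_r V E) in
  match A with
  | Atomic _ => polar (fun _ => False) (fun _ => False)
  | Arrow A B => polar (arrow_l (fst (red A)) (fst (red B)))
                       (arrow_r (fst (red A)) (snd (red B)))
  | Minus A B => polar (minus_l (fst (red A)) (snd (red B)))
                       (minus_r (snd (red A)) (snd (red B)))
  end.

Lemma arrow_candidate LA RA LB RB :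
  candidate LA RA -> candidate LB RB ->
  candidate (polar_l (arrow_l LA LB) (arrow_r LA RB))
            (polar_r (arrow_l LA LB) (arrow_r LA RB)).
Proof.
  intros CA CB. apply polar_candidate.
  - intros [| t | |] Ht; try contradiction. apply SN_LLam.
    exact (SN_subst_l _ _ _ (cand_SN_l _ _ CB _ (Ht _ (cand_LVar _ _ CA 0)))).
  - intros [| | | t u] Hu; try contradiction. destruct Hu.
    apply SN_RApp; [apply (cand_SN_l _ _ CA) | apply (cand_SN_r _ _ CB)]; assumption.
  - intros t t' Ht H. destruct H; try contradiction. intros a Ha.
    eapply (cand_step_l _ _ CB); [exact (Ht a Ha) |]. now apply step_subst_l.
  - intros u u' Hu H. destruct H; try contradiction; destruct Hu; split; auto.
    + now apply (cand_step_l _ _ CA t).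
    + now apply (cand_step_r _ _ CB u).
  (* The contractum is a cut at the domain type: [mu x <t,u>] belongs to [RA], because replacing [x]
     by an element of [LA] gives a cut between [LB] and [RB]. *)
  - intros t t' u Ht [Ht' Hu]. apply (cand_Cut _ _ CA); [assumption |].
    apply (cand_RMu _ _ CA). intros a Ha. unfold subst0_l. simpl.
    rewrite subst_shift_l_r, subst_id_r. apply (cand_Cut _ _ CB); auto.
  - contradiction.
Qed.

Lemma minus_candidate LA RA LB RB :
  candidate LA RA -> candidate LB RB ->
  candidate (polar_l (minus_l LA RB) (minus_r RA RB))
            (polar_r (minus_l LA RB) (minus_r RA RB)).
Proof.
  intros CA CB. apply polar_candidate.
  - intros [| | | u t] Ht; try contradiction. destruct Ht.
    apply SN_LApp; [apply (cand_SN_r _ _ CB) | apply (cand_SN_l _ _ CA)]; assumption.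
  - intros [| u | |] Hu; try contradiction. apply SN_RLam.
    exact (SN_subst_r _ _ _ (cand_SN_r _ _ CA _ (Hu _ (cand_RVar _ _ CB 0)))).
  - intros t t' Ht H. destruct H; try contradiction; destruct Ht; split; auto.
    + now apply (cand_step_r _ _ CB u).
    + now apply (cand_step_l _ _ CA t).
  - intros u u' Hu H. destruct H; try contradiction. intros b Hb.
    eapply (cand_step_r _ _ CA); [exact (Hu b Hb) |]. now apply step_subst_r.
  - contradiction.
  (* Dually, the contractum is a cut at the second type: [mu alpha <t,u>] belongs to [LB], because
     replacing [alpha] by an element of [RB] gives a cut between [LA] and [RA]. *)
  - intros u' t u [Ht Hu'] Hu. apply (cand_Cut _ _ CB); [| assumption].
    apply (cand_LMu _ _ CB). intros b Hb. unfold subst0_r. simpl.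
    rewrite subst_shift_r_l, subst_id_l. apply (cand_Cut _ _ CA); auto.
Qed.

Lemma red_candidate {Atom} (A : type Atom) : candidate (fst (red A)) (snd (red A)).
Proof.
  induction A as [a | A IHA B IHB | A IHA B IHB]; simpl.
  - apply polar_candidate; contradiction.
  - now apply arrow_candidate with (RA := snd (red A)).
  - now apply minus_candidate with (LB := fst (red B)).
Qed.

Lemma red_Cut {Atom} (A : type Atom) t u :
  fst (red A) t -> snd (red A) u -> SN step_c (Cut t u).
Proof. apply cand_Cut, red_candidate. Qed.

(** * Adequacy: typed terms are reducible under reducible substitutions *)

Definition red_subst {Atom T} (P : type Atom -> T -> Prop) (G : context Atom)
    (s : nat -> T) : Prop :=
  forall n A, nth_error G n = Some A -> P A (s n).

Lemma red_subst_scons {Atom T} (P : type Atom -> T -> Prop) G s A a :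
  P A a -> red_subst P G s -> red_subst P (A :: G) (scons a s).
Proof.
  intros Ha Hs [|n] B; simpl; [intros [= <-]; exact Ha | apply Hs].
Qed.

(** By induction on the derivation. In each binder case the candidate tests the body on an arbitrary
    reducible argument, and instantiating the lifted substitution by it gives a reducible extension,
    to which the induction hypothesis applies. *)
Lemma typing_red {Atom} :
  let red_l (A : type Atom) := fst (red A) in
  let red_r (A : type Atom) := snd (red A) in
  (forall G c D, typing_c G c D -> forall s k,
     red_subst red_l G s -> red_subst red_r D k -> SN step_c (subst_c s k c)) /\
  (forall G t A D, typing_l G t A D -> forall s k,
     red_subst red_l G s -> red_subst red_r D k -> red_l A (subst_l s k t)) /\
  (forall G u A D, typing_r G u A D -> forall s k,
     red_subst red_l G s -> red_subst red_r D k -> red_r A (subst_r s k u)).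
Proof.
  intros red_l red_r.
  apply (typing_mutind Atom); unfold red_l, red_r; simpl.
  - intros G D t u A _ IHt _ IHu s k Hs Hk. apply (red_Cut A); auto.
  - intros G D n A Hn s k Hs Hk. now apply Hs.
  - intros G D t A B _ IH s k Hs Hk. apply polar_l_fold. intros a Ha.
    rewrite subst_l_up_inst. apply IH; [now apply red_subst_scons | assumption].
  - intros G D u t A B _ IHt _ IHu s k Hs Hk. apply polar_l_fold. split; auto.
  - intros G D c A _ IH s k Hs Hk. apply (cand_LMu _ _ (red_candidate A)).
    intros b Hb. rewrite subst0_r_subst.
    apply IH; [assumption | now apply red_subst_scons].
  - intros G D n A Hn s k Hs Hk. now apply Hk.
  - intros G D t u A B _ IHt _ IHu s k Hs Hk. split; auto.
  - intros G D u A B _ IH s k Hs Hk b Hb.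
    rewrite subst_r_up_inst. apply IH; [assumption | now apply red_subst_scons].
  - intros G D c A _ IH s k Hs Hk. apply (cand_RMu _ _ (red_candidate A)).
    intros a Ha. rewrite subst0_l_subst.
    apply IH; [now apply red_subst_scons | assumption].
Qed.

Lemma red_subst_LVar {Atom} (G : context Atom) :
  red_subst (fun A => fst (red A)) G LVar.
Proof. intros n A _. apply (cand_LVar _ _ (red_candidate A)). Qed.

Lemma red_subst_RVar {Atom} (D : context Atom) :
  red_subst (fun A => snd (red A)) D RVar.
Proof. intros n A _. apply (cand_RVar _ _ (red_candidate A)). Qed.

Theorem theorem3p18 (Atom : Type) :
  (forall c : cterm, typed_c Atom c -> strongly_normalizing step_c c) /\
  (forall t : lterm, typed_l Atom t -> strongly_normalizing step_l t) /\
  (forall u : rterm, typed_r Atom u -> strongly_normalizing step_r u).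
Proof.
  destruct (@typing_red Atom) as [Hc [Hl Hr]].
  split; [| split].
  (* The term is written as its own instance under the identity substitution, so that adequacy
     applies. *)
  - intros c (G & D & H). apply SN_strongly_normalizing. rewrite <- subst_id_c.
    exact (Hc _ _ _ H _ _ (red_subst_LVar G) (red_subst_RVar D)).
  - intros t (G & A & D & H). apply SN_strongly_normalizing. rewrite <- subst_id_l.
    apply (cand_SN_l _ _ (red_candidate A)).
    exact (Hl _ _ _ _ H _ _ (red_subst_LVar G) (red_subst_RVar D)).
  - intros u (G & A & D & H). apply SN_strongly_normalizing. rewrite <- subst_id_r.
    apply (cand_SN_r _ _ (red_candidate A)).
    exact (Hr _ _ _ _ H _ _ (red_subst_LVar G) (red_subst_RVar D)).
Qed.
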